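(* There is an absolute constant $c>0$ such that for every auction representation language $L$, every $m\ge1$, and every $H$ with $1<H<2^{m/400}$, there exists a distribution $\mathcal{D}$ over valuations in $[1,H]^m$ such that every auction of $L$-complexity at most $2^{m/400}$ has revenue on $\mathcal{D}$ at most $\frac{c}{\log H}\,\mathrm{OPT}(\mathcal{D})$.
   Context: Setting: a single unit-demand bidder and $m$ items. A valuation is a vector $v=(v(1),\dots,v(m))$. An auction (menu) is a set of entries $(x,p)$ with $x_j\ge0$, $\sum_j x_j\le1$ ($x_j$ the probability of receiving item $j$) and price $p\ge0$; the entry $(0,0)$ is always available. A bidder with valuation $v$ selects an entry maximizing $\sum_j x_jv(j)-p$ (ties broken in favor of the higher price) and pays its price. The revenue of an auction on $\mathcal{D}$ is the expected payment for $v\sim\mathcal{D}$. $\mathrm{OPT}(\mathcal{D})$ is the supremum of revenue on $\mathcal{D}$ over all auctions. An auction representation language is an arbitrary function $L$ from finite binary strings to auctions; the $L$-complexity of an auction is the length of the shortest binary string that $L$ maps to it (infinite if none). *)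

(* Defs.v *)
From Stdlib Require Import Reals List.
Open Scope R_scope.

Fixpoint sumR (n : nat) (f : nat -> R) : R :=
  match n with O => 0 | S k => sumR k f + f k end.

(* A menu entry (x, p): x j = probability of receiving item j (j < m), p = price. *)
Definition entry := ((nat -> R) * R)%type.

Definition valid_entry (m : nat) (e : entry) : Prop :=
  (forall j, (j < m)%nat -> 0 <= fst e j) /\ sumR m (fst e) <= 1 /\ 0 <= snd e.

Record auction (m : nat) := {
  menu : entry -> Prop;
  menu_valid : forall e, menu e -> valid_entry m e }.
Arguments menu {m}.

Definition zero_entry : entry := (fun _ => 0, 0).

Definition available {m} (A : auction m) (e : entry) : Prop :=
  menu A e \/ e = zero_entry.

Definition utility (m : nat) (v : nat -> R) (e : entry) : R :=
  sumR m (fun j => fst e j * v j) - snd e.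

Definition selects {m} (A : auction m) (v : nat -> R) (e : entry) : Prop :=
  available A e /\
  (forall e', available A e' -> utility m v e' <= utility m v e) /\
  (forall e', available A e' -> utility m v e' = utility m v e -> snd e' <= snd e).

Definition pays {m} (A : auction m) (v : nat -> R) (p : R) : Prop :=
  exists e, selects A v e /\ snd e = p.

(* finitely supported distribution: list of (valuation, probability) *)
Definition fdist := list ((nat -> R) * R).

Definition is_dist (D : fdist) : Prop :=
  Forall (fun vw => 0 <= snd vw) D /\
  fold_right (fun vw s => snd vw + s) 0 D = 1.

Definition supported_in (m : nat) (H : R) (D : fdist) : Prop :=
  Forall (fun vw => forall j, (j < m)%nat -> 1 <= fst vw j <= H) D.

(* revenue_is A D r : the expected payment of A on D is (well defined and) r.
   Atoms of probability 0 are irrelevant. *)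
Fixpoint revenue_is {m} (A : auction m) (D : fdist) (r : R) : Prop :=
  match D with
  | nil => r = 0
  | (v, w) :: D' => exists p r',
      (w <> 0 -> pays A v p) /\ revenue_is A D' r' /\ r = w * p + r'
  end.

Definition is_OPT (m : nat) (D : fdist) (o : R) : Prop :=
  is_lub (fun r => exists A : auction m, revenue_is A D r) o.

Definition complexity_le {m} (L : list bool -> auction m) (A : auction m) (k : R) : Prop :=
  exists s : list bool, L s = A /\ INR (length s) <= k.

(* Main.v *)
(** A valuation worth [h] on a set [S] of items and [1] elsewhere is a
    one-parameter type.  If [h] is drawn from the equal-revenue distribution on
    [1, 2, 4, ..., 2^k] (with [2^k <= H]), every fixed auction earns at most [2]
    from it, although the mean of [h] is of order [log H].  Take exponentially
    many sets [S_i] of equal size [b] with pairwise intersections at most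
    [2b/3] and draw an independent [h_i] for each.  By a Chernoff bound some
    realisation of the [h_i] is bad for all the auctions of low complexity
    simultaneously while the average of the [h_i] stays of order [log H]; an
    auction that knows the realisation sells the uniform lottery on [S_i] for
    [h_i / 3], and the small intersections make it incentive compatible.  Both
    random choices (of the sets and of the [h_i]) are derandomised by
    conditional expectations. *)

Require Import Defs.
From Stdlib Require Import Reals ZArith List Lra Lia ClassicalEpsilon.
Open Scope R_scope.

(** * Finite sums *)

Lemma sumR_le (n : nat) (f g : nat -> R) :
  (forall i, (i < n)%nat -> f i <= g i) -> sumR n f <= sumR n g.
Proof.
induction n as [|n IH]; simpl; intros Hfg; [lra|].
assert (H1 := Hfg n ltac:(lia)).
assert (H2 : sumR n f <= sumR n g) by (apply IH; intros; apply Hfg; lia).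
lra.
Qed.

Lemma sumR_ext (n : nat) (f g : nat -> R) :
  (forall i, (i < n)%nat -> f i = g i) -> sumR n f = sumR n g.
Proof.
intros Hfg; apply Rle_antisym; apply sumR_le; intros i Hi; rewrite (Hfg i Hi); lra.
Qed.

Lemma sumR_plus (n : nat) (f g : nat -> R) :
  sumR n (fun i => f i + g i) = sumR n f + sumR n g.
Proof. induction n as [|n IH]; simpl; [|rewrite IH]; ring. Qed.

Lemma sumR_scal (n : nat) (a : R) (f : nat -> R) :
  sumR n (fun i => a * f i) = a * sumR n f.
Proof. induction n as [|n IH]; simpl; [|rewrite IH]; ring. Qed.

Lemma sumR_const (n : nat) (a : R) : sumR n (fun _ => a) = INR n * a.
Proof. induction n as [|n IH]; [simpl|rewrite S_INR; simpl; rewrite IH]; ring. Qed.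

Lemma sumR_ge0 (n : nat) (f : nat -> R) :
  (forall i, (i < n)%nat -> 0 <= f i) -> 0 <= sumR n f.
Proof.
intros Hf; assert (H := sumR_le n (fun _ => 0) f Hf); rewrite sumR_const in H; lra.
Qed.

Lemma sumR_add (a b : nat) (f : nat -> R) :
  sumR (a + b) f = sumR a f + sumR b (fun i => f (a + i)%nat).
Proof.
induction b as [|b IH].
- rewrite Nat.add_0_r; simpl; ring.
- rewrite Nat.add_succ_r; simpl; rewrite IH; ring.
Qed.

(** * Derandomisation by conditional expectations *)

Lemma weighted_average_attained (k : nat) (w f : nat -> R) (C : R) :
  (forall t, 0 <= w t) -> sumR (S k) w = 1 ->
  sumR (S k) (fun t => w t * f t) <= C ->
  exists t, (t <= k)%nat /\ f t <= C.
Proof.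
intros Hw Hsum Hle.
destruct (classic (exists t, (t <= k)%nat /\ f t <= C)) as [|Hno]; [easy|exfalso].
assert (Hf : forall t, (t <= k)%nat -> C < f t).
{ intros t Ht; apply Rnot_le_lt; intros H; apply Hno; exists t; auto. }
assert (Hpos : exists t, (t <= k)%nat /\ 0 < w t).
{ destruct (classic (exists t, (t <= k)%nat /\ 0 < w t)) as [|Hz]; [easy|exfalso].
  assert (H : sumR (S k) w <= sumR (S k) (fun _ => 0)).
  { apply sumR_le; intros t Ht; apply Rnot_lt_le; intros H; apply Hz.
    exists t; split; [lia|easy]. }
  rewrite sumR_const in H; lra. }
destruct Hpos as (t0 & Ht0 & Hwt0).
(* The surplus of the positive-weight index [t0] enters once [n] passes it. It makes the final
   inequality strict, contradicting the bound [C] on the average. *)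
assert (Hstrict : forall n, (n <= S k)%nat ->
  C * sumR n w + (if Nat.ltb t0 n then w t0 * (f t0 - C) else 0)
    <= sumR n (fun t => w t * f t)).
{ induction n as [|n IH]; intros Hn.
  - replace (t0 <? 0)%nat with false by (symmetry; apply Nat.ltb_ge; lia).
    simpl; lra.
  - specialize (IH ltac:(lia)); simpl sumR.
    assert (Hn' := Hf n ltac:(lia)); assert (Hwn := Hw n).
    destruct (Nat.ltb_spec t0 (S n)); destruct (Nat.ltb_spec t0 n);
      try lia; try nra.
    replace n with t0 in * by lia; lra. }
specialize (Hstrict (S k) (le_n _)).
destruct (Nat.ltb_spec t0 (S k)); [|lia].
assert (H1 := Hf t0 Ht0); rewrite Hsum in Hstrict; nra.
Qed.

Definition sum_list {T : Type} (f : T -> R) (l : list T) : R :=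
  fold_right (fun x s => f x + s) 0 l.

Lemma sum_list_ge {T : Type} (f : T -> R) (l : list T) (x : T) :
  (forall y, 0 <= f y) -> In x l -> f x <= sum_list f l.
Proof.
intros Hf; induction l as [|a l IH]; simpl; [easy|].
assert (H0 : 0 <= sum_list f l).
{ clear IH; induction l as [|c l IH]; simpl; [lra|]; specialize (Hf c); lra. }
intros [->|Hx]; [lra|]; specialize (IH Hx); specialize (Hf a); lra.
Qed.

(* The method of conditional expectations for exponential moments: the potential
   [sum over g of exp (partial sum of g)] does not increase in mean. *)
Lemma conditional_expectations (k : nat) (w : nat -> R)
    (tests : list (nat -> nat -> R)) (n : nat) :
  (forall t, 0 <= w t) -> sumR (S k) w = 1 ->
  (forall g i, In g tests -> sumR (S k) (fun t => w t * exp (g i t)) <= 1) ->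
  exists h : nat -> nat, (forall i, (h i <= k)%nat) /\
    forall g, In g tests ->
      sumR n (fun i => g i (h i)) <= ln (INR (length tests)).
Proof.
intros Hw Hsum Htests.
assert (Hpot : exists h : nat -> nat, (forall i, (h i <= k)%nat) /\
  sum_list (fun g => exp (sumR n (fun i => g i (h i)))) tests
    <= INR (length tests)).
{ induction n as [|n (h & Hh & IH)].
  - exists (fun _ => O); split; [intros; lia|].
    clear Htests; induction tests as [|g l IH]; [simpl; lra|].
    change (exp 0 + sum_list (fun _ : nat -> nat -> R => exp 0) l <= INR (S (length l))).
    rewrite S_INR; rewrite exp_0 in *; simpl in IH; rewrite exp_0 in IH; lra.
  (* [P g] is the contribution of [g] for the values fixed so far. Each new factor [exp (g n t)] has
     mean at most 1, so some [t] keeps the total potential below the bound. *)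
  - set (P g := exp (sumR n (fun i => g i (h i)))).
    destruct (weighted_average_attained k w
      (fun t => sum_list (fun g => P g * exp (g n t)) tests)
      (INR (length tests)) Hw Hsum) as (t & Ht & Hpt).
    { apply Rle_trans with (sum_list P tests); [|exact IH].
      clear IH; induction tests as [|g l IH]; simpl sum_list.
      - rewrite (sumR_ext _ _ (fun _ => 0)) by (intros; simpl; ring).
        rewrite sumR_const; lra.
      - rewrite (sumR_ext _ _ (fun t => P g * (w t * exp (g n t))
          + w t * sum_list (fun g => P g * exp (g n t)) l))
          by (intros; ring).
        rewrite sumR_plus, sumR_scal.
        assert (H1 := Htests g n (or_introl eq_refl)).
        assert (H2 : 0 < P g) by apply exp_pos.
        specialize (IH (fun g' i Hg => Htests g' i (or_intror Hg))).
        nra. }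
    exists (fun i => if Nat.eqb i n then t else h i); split.
    { intros i; destruct (Nat.eqb i n); auto. }
    apply Rle_trans with (2 := Hpt).
    apply Req_le; unfold sum_list; clear; induction tests as [|g l IH];
      cbn [fold_right]; [reflexivity|].
    rewrite IH; f_equal.
    simpl sumR; rewrite Nat.eqb_refl, exp_plus; unfold P; do 2 f_equal.
    apply sumR_ext; intros i Hi.
    destruct (Nat.eqb_spec i n); [lia|reflexivity]. }
destruct Hpot as (h & Hh & Hpot); exists h; split; [exact Hh|].
(* All terms of the potential are positive, so each one alone is at most the number of tests. *)
intros g Hg; apply Rnot_lt_le; intros Hlt; apply exp_increasing in Hlt.
rewrite exp_ln in Hlt.
- apply (Rlt_not_le _ _ Hlt); eapply Rle_trans; [|exact Hpot].
  apply (sum_list_ge (fun g => exp (sumR n (fun i => g i (h i)))));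
    [intros; left; apply exp_pos|exact Hg].
- apply lt_0_INR; destruct tests; simpl in *; [easy|lia].
Qed.

(** * Binary codes and the item sets they encode *)

Definition agree (b : nat) (x y : nat -> nat) : R :=
  sumR b (fun l => if Nat.eqb (x l) (y l) then 1 else 0).

Lemma agree_sym (b : nat) (x y : nat -> nat) : agree b x y = agree b y x.
Proof. apply sumR_ext; intros; rewrite Nat.eqb_sym; reflexivity. Qed.

Lemma agree_refl (b : nat) (x : nat -> nat) : agree b x x = INR b.
Proof.
unfold agree; rewrite (sumR_ext _ _ (fun _ => 1)).
- rewrite sumR_const; ring.
- intros; rewrite Nat.eqb_refl; reflexivity.
Qed.

Lemma ln_le (x y : R) : 0 < x -> x <= y -> ln x <= ln y.
Proof. intros Hx [Hxy| ->]; [left; apply ln_increasing|right]; auto. Qed.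

Lemma ln_2_bounds : / 2 < ln 2 <= 1.
Proof.
split; [exact ln_lt_2|].
rewrite <- (ln_exp 1); apply ln_le; [lra|].
assert (H := exp_ineq1_le 1); lra.
Qed.

(** [(3/2)^5 = 243/32] is below [2^3]. The resulting ratio [3/5] leaves room below the agreement
    rate [2/3] of the code. *)
Lemma ln_three_halves : 5 * ln (3 / 2) <= 3 * ln 2.
Proof.
replace 5 with (INR 5) by (simpl; ring); replace 3 with (INR 3) at 2 by (simpl; ring).
rewrite <- !ln_pow by lra; apply ln_le; simpl; lra.
Qed.

(** Words are added greedily. A uniformly random word agrees with a fixed one in about half of the
    positions, and a Chernoff bound with a union over the earlier words leaves a good choice. *)
Lemma binary_code (b n : nat) : (50 * n <= b)%nat ->
  exists word : nat -> nat -> nat, (forall i l, (word i l <= 1)%nat) /\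
    forall i j, (i < 2 ^ n)%nat -> (j < 2 ^ n)%nat -> i <> j ->
      agree b (word i) (word j) <= 2 / 3 * INR b.
Proof.
intros Hnb.
enough (H : forall N, (N <= 2 ^ n)%nat ->
  exists word : nat -> nat -> nat, (forall i l, (word i l <= 1)%nat) /\
    forall i j, (i < j < N)%nat ->
      agree b (word i) (word j) <= 2 / 3 * INR b).
{ destruct (H (2 ^ n)%nat (le_n _)) as (word & Hw & Ha).
  exists word; split; [exact Hw|]; intros i j Hi Hj Hij.
  destruct (Nat.lt_ge_cases i j); [apply Ha; lia|].
  rewrite agree_sym; apply Ha; lia. }
induction N as [|N IH]; intros HN.
- exists (fun _ _ => O); split; intros; lia.
- destruct (IH ltac:(lia)) as (word & Hbit & Ha).
  (* A fair bit gives [exp (ln 2 * [agreement])] the mean [(2 + 1) / 2 = 3/2]; subtracting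
     [ln (3/2)] normalises it to 1. *)
  set (test i := fun l c : nat =>
    (if Nat.eqb (word i l) c then ln 2 else 0) - ln (3 / 2)).
  destruct (conditional_expectations 1 (fun _ => / 2)
    (map test (seq 0 N)) b) as (h & Hh & Htest).
  + intros; lra.
  + simpl; lra.
  + intros g l Hg; apply in_map_iff in Hg; destruct Hg as (i & <- & _).
    unfold test; simpl.
    assert (E1 : exp (ln 2 - ln (3/2)) = 4 / 3).
    { unfold Rminus; rewrite exp_plus, exp_Ropp, !exp_ln by lra; field. }
    assert (E2 : exp (0 - ln (3/2)) = 2 / 3).
    { unfold Rminus; rewrite exp_plus, exp_0, exp_Ropp, !exp_ln by lra; field. }
    specialize (Hbit i l).
    destruct (word i l) as [|[|?]]; [| |lia]; simpl; rewrite E1, E2; lra.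
  + exists (fun i => if Nat.eqb i N then h else word i); split.
    { intros i l; destruct (Nat.eqb i N); auto. }
    intros i j Hij.
    destruct (Nat.eqb_spec i N); [lia|].
    destruct (Nat.eqb_spec j N); [|apply Ha; lia].
    assert (Hi := Htest (test i) (in_map test _ _ (proj2 (in_seq N 0 i) ltac:(lia)))).
    rewrite length_map, length_seq in Hi; unfold test in Hi.
    rewrite (sumR_ext _ _ (fun l =>
      ln 2 * (if Nat.eqb (word i l) (h l) then 1 else 0) + - ln (3 / 2))) in Hi
      by (intros; destruct (Nat.eqb _ _); ring).
    rewrite sumR_plus, sumR_scal, sumR_const in Hi.
    fold (agree b (word i) h) in Hi.
    assert (HlnN : ln (INR N) <= INR n * ln 2).
    { rewrite <- ln_pow by lra; apply ln_le; [apply lt_0_INR; lia|].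
      replace 2 with (INR 2) by reflexivity; rewrite <- pow_INR.
      apply le_INR; lia. }
    assert (Hnb' : 50 * INR n <= INR b).
    { replace 50 with (INR 50) by (simpl; ring).
      rewrite <- mult_INR; apply le_INR, Hnb. }
    assert (H1 := ln_three_halves); assert (H2 := ln_2_bounds).
    assert (Hb := pos_INR b).
    (* Divided by [ln 2], the test bounds the agreement by [n + 3b/5], hence by
       [b/50 + 3b/5 <= 2b/3]. *)
    apply Rmult_le_reg_l with (ln 2); [lra|]; nra.
Qed.

(* The two choices for the bit at position [l < b] correspond to the items [l]
   and [b + l]; items from [2b] on belong to no set. *)
Definition ind (b : nat) (x : nat -> nat) (j : nat) : R :=
  if Nat.ltb j b then (if Nat.eqb (x j) 0 then 1 else 0)
  else if Nat.ltb j (b + b) then (if Nat.eqb (x (j - b)%nat) 1 then 1 else 0)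
  else 0.

Lemma ind_01 (b : nat) (x : nat -> nat) (j : nat) : ind b x j = 0 \/ ind b x j = 1.
Proof.
unfold ind; destruct (Nat.ltb j b), (Nat.ltb j (b + b)); auto;
  match goal with |- context [Nat.eqb ?u ?w] => destruct (Nat.eqb u w) end; auto.
Qed.

(** Each word takes exactly one of the items [l] and [b + l], so this pair contributes 1 if the bits
    agree and 0 otherwise. With [x = y] it follows that every set has size [b]. *)
Lemma sum_ind_ind (b m : nat) (x y : nat -> nat) : (b + b <= m)%nat ->
  (forall l, (x l <= 1)%nat) -> (forall l, (y l <= 1)%nat) ->
  sumR m (fun j => ind b x j * ind b y j) = agree b x y.
Proof.
intros Hm Hx Hy.
replace m with (b + (b + (m - (b + b))))%nat by lia.
rewrite sumR_add, sumR_add, <- Rplus_assoc, <- sumR_plus.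
rewrite (sumR_ext (m - (b + b)) _ (fun _ => 0)), sumR_const.
- rewrite Rmult_0_r, Rplus_0_r; apply sumR_ext; intros l Hl; unfold ind.
  destruct (Nat.ltb_spec l b); [|lia].
  destruct (Nat.ltb_spec (b + l) b); [lia|].
  destruct (Nat.ltb_spec (b + l) (b + b)); [|lia].
  replace (b + l - b)%nat with l by lia.
  specialize (Hx l); specialize (Hy l).
  destruct (x l) as [|[|?]], (y l) as [|[|?]]; simpl; lra || lia.
- intros l Hl; unfold ind.
  destruct (Nat.ltb_spec (b + (b + l)) b); [lia|].
  destruct (Nat.ltb_spec (b + (b + l)) (b + b)); [lia|ring].
Qed.

(** * One-parameter types and the entries they choose *)

Definition val (s : nat -> R) (h : R) (j : nat) : R := h * s j + (1 - s j).

Lemma utility_val (m : nat) (s : nat -> R) (h : R) (e : entry) :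
  utility m (val s h) e =
    h * sumR m (fun j => fst e j * s j)
    + sumR m (fun j => fst e j * (1 - s j)) - snd e.
Proof.
unfold utility, val; f_equal; rewrite <- sumR_scal, <- sumR_plus.
apply sumR_ext; intros; ring.
Qed.

Lemma available_valid {m : nat} (A : auction m) (e : entry) :
  available A e -> valid_entry m e.
Proof.
intros [He| ->]; [exact (menu_valid m A e He)|].
split; [|split]; simpl; [intros; lra| |lra].
rewrite sumR_const; lra.
Qed.

(** Individual rationality: the entry [(0, 0)] is available, so the price is at most the expected
    value of the allocation. *)
Lemma selected_price_le {m : nat} (A : auction m) (v : nat -> R) (H : R) (e : entry) :
  0 <= H -> (forall j, (j < m)%nat -> v j <= H) -> selects A v e -> snd e <= H.
Proof.
intros HH Hv (Hav & Hopt & _).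
specialize (Hopt zero_entry (or_intror eq_refl)).
destruct (available_valid A e Hav) as (H0 & H1 & _).
unfold utility in Hopt; simpl in Hopt.
rewrite (sumR_ext m (fun j => 0 * v j) (fun _ => 0)), sumR_const in Hopt
  by (intros; ring).
assert (H2 : sumR m (fun j => fst e j * v j) <= H * sumR m (fst e)).
{ rewrite <- sumR_scal; apply sumR_le; intros j Hj.
  specialize (H0 j Hj); specialize (Hv j Hj); nra. }
nra.
Qed.

Lemma pays_unique {m : nat} (A : auction m) (v : nat -> R) (p q : R) :
  pays A v p -> pays A v q -> p = q.
Proof.
intros (e & (Ha & Ho & Ht) & <-) (e' & (Ha' & Ho' & Ht') & <-).
assert (E : utility m v e = utility m v e').
{ apply Rle_antisym; auto. }
apply Rle_antisym; auto.
Qed.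

(* A menu need not attain its supremum at [v]; then the fallback [e0] is kept. *)
Definition improves {m : nat} (A : auction m) (v : nat -> R) (e0 e : entry) : Prop :=
  available A e /\ utility m v e0 <= utility m v e /\
  (forall p, pays A v p -> p = snd e) /\ (selects A v e \/ e = e0).

Definition best {m : nat} (A : auction m) (v : nat -> R) (e0 : entry) : entry :=
  epsilon (inhabits e0) (improves A v e0).

Lemma best_improves {m : nat} (A : auction m) (v : nat -> R) (e0 : entry) :
  available A e0 -> improves A v e0 (best A v e0).
Proof.
intros H0; unfold best; apply epsilon_spec.
destruct (classic (exists e, selects A v e)) as [(e & He)|Hno].
- exists e; split; [apply He|split; [apply He, H0|split; [|now left]]].
  intros p Hp; apply (pays_unique A v); [exact Hp|exists e; auto].
- exists e0; split; [exact H0|split; [lra|split; [|now right]]].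
  intros p (e & He & _); exfalso; apply Hno; exists e; exact He.
Qed.

(** Each scale falls back on the entry of the scale below, so the chosen entry is always at least as
    good as the previous one, and the first at least as good as [zero_entry]. These are the only
    incentive constraints used in the revenue bound, and they hold even where no selection
    exists. *)
Fixpoint chosen {m : nat} (A : auction m) (s : nat -> R) (t : nat) : entry :=
  match t with
  | O => best A (val s 1) zero_entry
  | S t' => best A (val s (2 ^ t)) (chosen A s t')
  end.

Lemma chosen_available {m : nat} (A : auction m) (s : nat -> R) (t : nat) :
  available A (chosen A s t).
Proof.
induction t as [|t IH]; simpl; apply best_improves; [right; reflexivity|exact IH].
Qed.

Lemma chosen_pays {m : nat} (A : auction m) (s : nat -> R) (t : nat) (p : R) :
  pays A (val s (2 ^ t)) p -> p = snd (chosen A s t).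
Proof.
destruct t as [|t]; simpl; apply best_improves;
  [right; reflexivity|apply chosen_available].
Qed.

Lemma val_bounds (s : nat -> R) (h : R) (j : nat) :
  (s j = 0 \/ s j = 1) -> 1 <= h -> 1 <= val s h j <= h.
Proof. unfold val; intros [-> | ->]; lra. Qed.

Lemma pow2_ge_1 (t : nat) : 1 <= 2 ^ t.
Proof. apply pow_R1_Rle; lra. Qed.

(** An entry is either selected at its own scale, where individual rationality bounds its price, or
    inherited from a smaller scale. *)
Lemma chosen_price {m : nat} (A : auction m) (s : nat -> R) (k t : nat) :
  (forall j, s j = 0 \/ s j = 1) -> (t <= k)%nat ->
  0 <= snd (chosen A s t) <= 2 ^ k.
Proof.
intros Hs Htk; split.
{ apply (available_valid A), chosen_available. }
assert (Hk := pow2_ge_1 k).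
induction t as [|t IH]; cbn [chosen].
- destruct (best_improves A (val s 1) zero_entry (or_intror eq_refl))
    as (_ & _ & _ & [Hsel| ->]); [|simpl; lra].
  apply (selected_price_le A (val s 1)); [lra| |exact Hsel].
  intros j _; assert (H := val_bounds s 1 j (Hs j) (Rle_refl 1)); lra.
- destruct (best_improves A (val s (2 ^ S t)) _ (chosen_available A s t))
    as (_ & _ & _ & [Hsel| ->]); [|apply IH; lia].
  apply (selected_price_le A (val s (2 ^ S t))); [lra| |exact Hsel].
  intros j _; assert (H := val_bounds s (2 ^ S t) j (Hs j) (pow2_ge_1 _)).
  assert (2 ^ S t <= 2 ^ k) by (apply Rle_pow; [lra|lia]); lra.
Qed.

(** * Revenue from the equal-revenue distribution *)

(* The equal-revenue distribution: [2 ^ t] has weight [eqrev k t], and a value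
   of at least [2 ^ t] has probability [2 ^ - t]. *)
Definition eqrev (k t : nat) : R := if Nat.ltb t k then / 2 ^ S t else / 2 ^ k.

Lemma eqrev_ge0 (k t : nat) : 0 <= eqrev k t.
Proof.
unfold eqrev; destruct (Nat.ltb t k); left; apply Rinv_0_lt_compat, pow_lt; lra.
Qed.

Lemma sum_eqrev (k : nat) (f : nat -> R) :
  sumR (S k) (fun t => eqrev k t * f t) =
  sumR k (fun t => / 2 ^ S t * f t) + / 2 ^ k * f k.
Proof.
change (sumR (S k) (fun t => eqrev k t * f t)) with
  (sumR k (fun t => eqrev k t * f t) + eqrev k k * f k).
unfold eqrev at 2; rewrite Nat.ltb_irrefl; f_equal.
apply sumR_ext; intros t Ht; unfold eqrev.
destruct (Nat.ltb_spec t k); [reflexivity|lia].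
Qed.

Lemma sum_eqrev_const (k : nat) (a : R) :
  sumR (S k) (fun t => eqrev k t * a) = a.
Proof.
rewrite sum_eqrev; induction k as [|k IH]; [simpl; field|].
apply eq_trans with (2 := IH); cbn [sumR].
assert (H := pow2_ge_1 k); simpl pow; field; lra.
Qed.

Lemma eqrev_mass (k : nat) : sumR (S k) (eqrev k) = 1.
Proof.
rewrite <- (sum_eqrev_const k 1); apply sumR_ext; intros; ring.
Qed.

Lemma eqrev_mean (k : nat) :
  sumR (S k) (fun t => eqrev k t * 2 ^ t) = INR k / 2 + 1.
Proof.
rewrite sum_eqrev, Rinv_l by (assert (H := pow2_ge_1 k); lra); f_equal.
rewrite (sumR_ext _ _ (fun _ => / 2)), sumR_const; [reflexivity|].
intros t _; assert (H := pow2_ge_1 t); simpl pow; field; lra.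
Qed.

(** Let [q t] and [r t] be the probabilities of an item inside and outside the set. Comparing
    consecutive scales bounds a price increment by [2^t] times the increment of [q] plus that of
    [r]. Weighting by the tail probability [2^-t] makes the [q] part telescope to [q k] and turns
    the [r] part into the mean of [r]; each is at most 1. *)
Lemma equal_revenue {m : nat} (A : auction m) (s : nat -> R) (k : nat) :
  (forall j, s j = 0 \/ s j = 1) ->
  sumR (S k) (fun t => eqrev k t * snd (chosen A s t)) <= 2.
Proof.
intros Hs.
set (q t := sumR m (fun j => fst (chosen A s t) j * s j)).
set (r t := sumR m (fun j => fst (chosen A s t) j * (1 - s j))).
assert (Hqr : forall t, 0 <= q t <= 1 /\ r t <= 1).
{ intros t; destruct (available_valid A _ (chosen_available A s t)) as (H0 & H1 & _).
  assert (E : q t + r t = sumR m (fst (chosen A s t))).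
  { unfold q, r; rewrite <- sumR_plus; apply sumR_ext; intros; ring. }
  assert (0 <= q t).
  { apply sumR_ge0; intros j Hj; specialize (H0 j Hj); destruct (Hs j) as [-> | ->]; lra. }
  assert (0 <= r t).
  { apply sumR_ge0; intros j Hj; specialize (H0 j Hj); destruct (Hs j) as [-> | ->]; lra. }
  lra. }
assert (Hkey : sumR (S k) (fun t => eqrev k t * snd (chosen A s t))
   <= q k + sumR (S k) (fun t => eqrev k t * r t)).
{ rewrite !sum_eqrev; clear Hqr; induction k as [|k IH].
  - destruct (best_improves A (val s 1) zero_entry (or_intror eq_refl))
      as (_ & H & _).
    rewrite !utility_val in H; simpl fst in H; simpl snd in H.
    change (best A (val s 1) zero_entry) with (chosen A s 0) in H.
    fold (q 0%nat) (r 0%nat) in H.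
    rewrite (sumR_ext m (fun j => 0 * s j) (fun _ => 0)),
      (sumR_ext m (fun j => 0 * (1 - s j)) (fun _ => 0)), !sumR_const in H
      by (intros; ring).
    cbn [sumR pow]; lra.
  - destruct (best_improves A (val s (2 ^ S k)) _ (chosen_available A s k))
      as (_ & H & _).
    rewrite !utility_val in H.
    change (best A (val s (2 ^ S k)) (chosen A s k)) with (chosen A s (S k)) in H.
    fold (q k) (r k) (q (S k)) (r (S k)) in H.
    cbn [sumR].
    assert (Hp := pow2_ge_1 k).
    (* Passing from [k] to [S k], half of the top mass stays at scale [k] and half moves up. The
       incentive constraint is multiplied by this half. *)
    assert (Ei : / 2 ^ k = 2 * / 2 ^ S k) by (simpl; field; lra).
    assert (Ej : / 2 ^ S k * 2 ^ S k = 1) by (apply Rinv_l; simpl; lra).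
    assert (Hi : 0 < / 2 ^ S k) by (apply Rinv_0_lt_compat; simpl; lra).
    rewrite Ei in IH.
    assert (Hm := Rmult_le_compat_l _ _ _ (Rlt_le _ _ Hi) H).
    set (a := / 2 ^ S k) in *; set (c := 2 ^ S k) in *.
    replace (a * (c * q k + r k - snd (chosen A s k))) with
      ((a * c) * q k + a * r k - a * snd (chosen A s k)) in Hm by ring.
    replace (a * (c * q (S k) + r (S k) - snd (chosen A s (S k)))) with
      ((a * c) * q (S k) + a * r (S k) - a * snd (chosen A s (S k))) in Hm by ring.
    rewrite Ej in Hm; lra. }
assert (sumR (S k) (fun t => eqrev k t * r t) <= sumR (S k) (fun t => eqrev k t * 1)).
{ apply sumR_le; intros t _; assert (H := eqrev_ge0 k t); specialize (Hqr t); nra. }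
rewrite sum_eqrev_const in *; specialize (Hqr k); lra.
Qed.

(** * Exponential moments of payments and scales *)

(** Inverting [exp (- x) >= 1 - x] gives [exp x <= 1 / (1 - x)], which is at most [1 + 2 * x] in
    this range. *)
Lemma exp_le_half (x : R) : 0 <= x <= / 2 -> exp x <= 1 + 2 * x.
Proof.
intros Hx; assert (H := exp_ineq1_le (- x)); assert (Hp := exp_pos x).
assert (E : exp x * exp (- x) = 1) by (rewrite <- exp_plus, Rplus_opp_r; apply exp_0).
nra.
Qed.

Lemma exp_opp_le (x : R) : 0 <= x <= 1 -> exp (- x) <= 1 - x / 2.
Proof.
intros Hx; assert (H := exp_ineq1_le x); assert (Hp := exp_pos (- x)).
assert (E : exp x * exp (- x) = 1) by (rewrite <- exp_plus, Rplus_opp_r; apply exp_0).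
nra.
Qed.

(** A payment [p] lies in [[0, H]], so [exp (p / (2H)) <= 1 + p / H], with mean at most
    [1 + 2/H <= exp (2/H)]. The shift by 4, twice the revenue bound, cancels this factor. *)
Lemma payment_moment {m : nat} (A : auction m) (s : nat -> R) (k : nat) (H : R) :
  (forall j, s j = 0 \/ s j = 1) -> 2 ^ k <= H ->
  sumR (S k) (fun t => eqrev k t * exp ((snd (chosen A s t) - 4) / (2 * H))) <= 1.
Proof.
intros Hs HkH; assert (Hk := pow2_ge_1 k).
apply Rle_trans with (exp (- (2 / H)) * (1 + 2 / H)).
- rewrite (sumR_ext _ _ (fun t => exp (- (2 / H)) *
    (eqrev k t * exp (snd (chosen A s t) / (2 * H))))).
  2:{ intros t _; replace ((snd (chosen A s t) - 4) / (2 * H)) with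
        (- (2 / H) + snd (chosen A s t) / (2 * H)) by (field; lra).
      rewrite exp_plus; ring. }
  rewrite sumR_scal; apply Rmult_le_compat_l; [left; apply exp_pos|].
  apply Rle_trans with (sumR (S k) (fun t =>
    eqrev k t * 1 + / H * (eqrev k t * snd (chosen A s t)))).
  + apply sumR_le; intros t Ht.
    assert (Hp := chosen_price A s k t Hs ltac:(lia)).
    assert (HH : 0 < / H) by (apply Rinv_0_lt_compat; lra).
    assert (HE : / H * H = 1) by (apply Rinv_l; lra).
    assert (Hx := exp_le_half (snd (chosen A s t) / (2 * H))).
    replace (snd (chosen A s t) / (2 * H)) with (/ H * snd (chosen A s t) / 2)
      in * by (field; lra).
    assert (Hx' : exp (/ H * snd (chosen A s t) / 2) <= 1 + / H * snd (chosen A s t)).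
    { eapply Rle_trans; [apply Hx; split; nra|lra]. }
    assert (Hw := eqrev_ge0 k t).
    assert (Hm := Rmult_le_compat_l _ _ _ Hw Hx'); lra.
  + rewrite sumR_plus, sum_eqrev_const, sumR_scal.
    assert (HR := equal_revenue A s k Hs).
    assert (0 < / H) by (apply Rinv_0_lt_compat; lra).
    unfold Rdiv; nra.
- assert (Hx := exp_ineq1_le (2 / H)); assert (Hp := exp_pos (- (2 / H))).
  assert (E : exp (2 / H) * exp (- (2 / H)) = 1)
    by (rewrite <- exp_plus, Rplus_opp_r; apply exp_0).
  nra.
Qed.

(** This controls the lower tail of the scales. Since [exp (- (2^t / H)) <= 1 - 2^t / (2H)], the
    mean is at most [1 - M / (2H) <= exp (- (M / (2H)))], where [M] is the mean scale; the shift
    [M / 2] cancels it. *)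
Lemma scale_moment (k : nat) (H : R) : 2 ^ k <= H ->
  sumR (S k) (fun t => eqrev k t * exp (((INR k / 2 + 1) / 2 - 2 ^ t) / H)) <= 1.
Proof.
intros HkH; assert (Hk := pow2_ge_1 k).
set (M := INR k / 2 + 1).
assert (HH : 0 < / H) by (apply Rinv_0_lt_compat; lra).
assert (HE : / H * H = 1) by (apply Rinv_l; lra).
apply Rle_trans with (exp (M / 2 / H) * (1 - M / 2 / H)).
- rewrite (sumR_ext _ _ (fun t => exp (M / 2 / H) *
    (eqrev k t * exp (- (2 ^ t / H))))).
  2:{ intros t _; replace ((M / 2 - 2 ^ t) / H) with
        (M / 2 / H + - (2 ^ t / H)) by (field; lra).
      rewrite exp_plus; ring. }
  rewrite sumR_scal; apply Rmult_le_compat_l; [left; apply exp_pos|].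
  apply Rle_trans with (sumR (S k) (fun t =>
    eqrev k t * 1 + - (/ H / 2) * (eqrev k t * 2 ^ t))).
  + apply sumR_le; intros t Ht.
    assert (Ht1 := pow2_ge_1 t).
    assert (Ht2 : 2 ^ t <= 2 ^ k) by (apply Rle_pow; [lra|lia]).
    assert (Hx : exp (- (2 ^ t / H)) <= 1 - 2 ^ t / H / 2).
    { apply exp_opp_le; unfold Rdiv; split; nra. }
    assert (Hm := Rmult_le_compat_l _ _ _ (eqrev_ge0 k t) Hx).
    unfold Rdiv in *; lra.
  + rewrite sumR_plus, sum_eqrev_const, sumR_scal, eqrev_mean; fold M.
    apply Req_le; field; lra.
- assert (Hx := exp_ineq1_le (- (M / 2 / H))); assert (Hp := exp_pos (M / 2 / H)).
  assert (E : exp (M / 2 / H) * exp (- (M / 2 / H)) = 1)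
    by (rewrite <- exp_plus, Rplus_opp_r; apply exp_0).
  nra.
Qed.

(** * Uniform distributions on finitely many types *)

Fixpoint uniform_on (w : R) (v : nat -> nat -> R) (n : nat) : fdist :=
  match n with O => nil | S k => (v k, w) :: uniform_on w v k end.

Lemma uniform_on_dist (v : nat -> nat -> R) (n : nat) :
  (0 < n)%nat -> is_dist (uniform_on (/ INR n) v n).
Proof.
intros Hn; apply lt_0_INR in Hn.
assert (Hw : 0 < / INR n) by (apply Rinv_0_lt_compat; lra).
split.
- generalize n at 2; intros N; induction N; simpl; constructor; simpl; auto; lra.
- assert (H : forall N, fold_right (fun vw s => snd vw + s) 0
    (uniform_on (/ INR n) v N) = INR N * / INR n).
  { induction N as [|N IH]; [simpl; ring|].
    rewrite S_INR; cbn [uniform_on fold_right snd]; rewrite IH; ring. }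
  rewrite H; apply Rinv_r; lra.
Qed.

Lemma uniform_on_supported (m : nat) (H w : R) (v : nat -> nat -> R) (n : nat) :
  (forall i j, (i < n)%nat -> (j < m)%nat -> 1 <= v i j <= H) ->
  supported_in m H (uniform_on w v n).
Proof.
intros Hv; unfold supported_in; induction n as [|n IH]; simpl; constructor; simpl.
- intros; apply Hv; lia.
- apply IH; intros; apply Hv; lia.
Qed.

(** [p] has to match only payments that exist, which suits menus whose supremum is not attained; a
    defined revenue supplies existence, because [w <> 0]. *)
Lemma revenue_uniform_on {m : nat} (A : auction m) (w : R) (v : nat -> nat -> R)
    (n : nat) (p : nat -> R) (r : R) :
  w <> 0 -> (forall i q, (i < n)%nat -> pays A (v i) q -> q = p i) ->
  revenue_is A (uniform_on w v n) r -> r = w * sumR n p.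
Proof.
intros Hw; revert r; induction n as [|n IH]; simpl; intros r Hp.
- intros ->; ring.
- intros (q & r' & Hq & Hr' & ->).
  rewrite (Hp n q ltac:(lia) (Hq Hw)), (IH r'); [ring| |exact Hr'].
  intros; apply Hp; auto.
Qed.

Lemma revenue_uniform_on_intro {m : nat} (A : auction m) (w : R)
    (v : nat -> nat -> R) (n : nat) (p : nat -> R) :
  (forall i, (i < n)%nat -> pays A (v i) (p i)) ->
  revenue_is A (uniform_on w v n) (w * sumR n p).
Proof.
induction n as [|n IH]; simpl; intros Hp; [ring|].
exists (p n), (w * sumR n p); split; [|split]; [auto|apply IH; auto|ring].
Qed.

Lemma revenue_le {m : nat} (A : auction m) (H : R) (D : fdist) (r : R) :
  0 <= H -> is_dist D -> supported_in m H D -> revenue_is A D r -> r <= H.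
Proof.
intros HH (Hw & H1) Hs Hr.
enough (Hle : r <= fold_right (fun vw s => snd vw + s) 0 D * H) by (rewrite H1 in Hle; lra).
clear H1; revert r Hr; induction D as [|(v, w) D IH]; simpl; intros r; [intros ->; lra|].
intros (p & r' & Hp & Hr' & ->).
inversion Hw as [|? ? Hw0 Hw']; inversion Hs as [|? ? Hs0 Hs']; subst; simpl in *.
specialize (IH Hw' Hs' _ Hr').
enough (w * p <= w * H) by lra.
destruct (Req_dec w 0) as [->|Hnz]; [lra|].
apply Rmult_le_compat_l; [exact Hw0|].
destruct (Hp Hnz) as (e & He & <-).
apply (selected_price_le A v); auto.
intros j Hj; apply Hs0, Hj.
Qed.

Definition empty_auction (m : nat) : auction m :=
  {| menu := fun _ => False; menu_valid := fun e (F : False) => match F with end |}.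

Lemma empty_auction_revenue (m : nat) (D : fdist) :
  revenue_is (empty_auction m) D 0.
Proof.
induction D as [|(v, w) D IH]; simpl; [reflexivity|].
exists 0, 0; split; [|split; [exact IH|ring]].
intros _; exists zero_entry; split; [|reflexivity].
split; [right; reflexivity|].
split; intros e' [[]| ->]; lra.
Qed.

(** Revenues are at most [H], and the empty auction earns 0, so completeness of the reals
    applies. *)
Lemma OPT_exists (m : nat) (H : R) (D : fdist) :
  0 <= H -> is_dist D -> supported_in m H D -> exists o, is_OPT m D o /\ 0 <= o.
Proof.
intros HH HD Hs.
destruct (completeness (fun r => exists A : auction m, revenue_is A D r)) as (o & Ho).
- exists H; intros r (A & Hr); apply (revenue_le A H D r); auto.
- exists 0, (empty_auction m); apply empty_auction_revenue.
- exists o; split; [exact Ho|].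
  apply Ho; exists (empty_auction m); apply empty_auction_revenue.
Qed.

(** * The auction that knows the realisation *)

Definition lottery (b : nat) (word : nat -> nat -> nat) (h : nat -> R) (i : nat) : entry :=
  (fun j => / INR b * ind b (word i) j, h i / 3).

Lemma lottery_allocation (b m : nat) (x y : nat -> nat) (p a : R) :
  (0 < b)%nat -> (b + b <= m)%nat ->
  (forall l, (x l <= 1)%nat) -> (forall l, (y l <= 1)%nat) ->
  utility m (val (ind b y) a) (fun j => / INR b * ind b x j, p) =
    1 + (a - 1) * (agree b x y / INR b) - p.
Proof.
intros Hb Hm Hx Hy; apply lt_0_INR in Hb.
rewrite utility_val; simpl fst; simpl snd.
rewrite (sumR_ext m (fun j => / INR b * ind b x j * ind b y j)
  (fun j => / INR b * (ind b x j * ind b y j))) by (intros; ring).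
(* An indicator equals its square, which reduces the sum to agreements. *)
rewrite (sumR_ext m (fun j => / INR b * ind b x j * (1 - ind b y j))
  (fun j => / INR b * (ind b x j * ind b x j) + - / INR b * (ind b x j * ind b y j)))
  by (intros j _; destruct (ind_01 b x j) as [-> | ->]; ring).
rewrite sumR_plus, !sumR_scal, !sum_ind_ind, agree_refl by auto.
field; lra.
Qed.

Lemma lottery_menu_valid (b m N : nat) (word : nat -> nat -> nat) (h : nat -> R) :
  (0 < b)%nat -> (b + b <= m)%nat -> (forall i l, (word i l <= 1)%nat) ->
  (forall i, 1 <= h i) ->
  forall e, (exists i, (i < N)%nat /\ e = lottery b word h i) -> valid_entry m e.
Proof.
intros Hb Hm Hbit Hh e (i & _ & ->); apply lt_0_INR in Hb.
assert (Hi : 0 < / INR b) by (apply Rinv_0_lt_compat; lra).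
split; [|split]; simpl.
- intros j _; destruct (ind_01 b (word i) j) as [-> | ->]; lra.
- rewrite sumR_scal, (sumR_ext m _ (fun j => ind b (word i) j * ind b (word i) j))
    by (intros j _; destruct (ind_01 b (word i) j) as [-> | ->]; ring).
  rewrite sum_ind_ind, agree_refl, Rinv_l by (auto; lra); lra.
- specialize (Hh i); lra.
Qed.

(** The own lottery yields [2/3 * h i]. Another one yields at most [1 + 2/3 * (h i - 1) - h j / 3],
    which is no more because [h j >= 1]. *)
Lemma lottery_auction (b m N : nat) (word : nat -> nat -> nat) (h : nat -> R) :
  (0 < b)%nat -> (b + b <= m)%nat -> (forall i l, (word i l <= 1)%nat) ->
  (forall i j, (i < N)%nat -> (j < N)%nat -> i <> j ->
     agree b (word i) (word j) <= 2 / 3 * INR b) ->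
  (forall i, 1 <= h i) ->
  exists A : auction m, forall i, (i < N)%nat ->
    pays A (val (ind b (word i)) (h i)) (h i / 3).
Proof.
intros Hb Hm Hbit Hagree Hh.
exists {| menu := fun e => exists i, (i < N)%nat /\ e = lottery b word h i;
          menu_valid := lottery_menu_valid b m N word h Hb Hm Hbit Hh |}.
intros i Hi; exists (lottery b word h i); split; [|reflexivity].
assert (Hb' := lt_0_INR b Hb).
assert (Hutil : forall j, utility m (val (ind b (word i)) (h i)) (lottery b word h j)
  = 1 + (h i - 1) * (agree b (word j) (word i) / INR b) - h j / 3).
{ intros j; apply lottery_allocation; auto. }
assert (Hown : utility m (val (ind b (word i)) (h i)) (lottery b word h i)
  = 2 / 3 * h i).
{ rewrite Hutil, agree_refl; field; lra. }
assert (Hother : forall j, (j < N)%nat -> j <> i ->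
  utility m (val (ind b (word i)) (h i)) (lottery b word h j)
    <= 1 + (h i - 1) * (2 / 3) - h j / 3).
{ intros j Hj Hji; rewrite Hutil.
  assert (Ha : agree b (word j) (word i) / INR b <= 2 / 3).
  { apply Rmult_le_reg_r with (INR b); [lra|].
    unfold Rdiv at 1; rewrite Rmult_assoc, Rinv_l by lra.
    rewrite Rmult_1_r; apply Hagree; auto. }
  specialize (Hh i); nra. }
assert (Hzero : utility m (val (ind b (word i)) (h i)) zero_entry = 0).
{ unfold utility; simpl; rewrite (sumR_ext m _ (fun _ => 0)), sumR_const by (intros; ring).
  ring. }
assert (Hhi := Hh i).
split; [left; exists i; auto|].
split; intros e' [(j & Hj & ->)| ->]; simpl.
- destruct (Nat.eq_dec j i) as [->|Hji]; [lra|].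
  specialize (Hother j Hj Hji); specialize (Hh j); lra.
- lra.
(* A tie forces [h j <= 1 <= h i], so the own lottery has the higher price. *)
- intros E; destruct (Nat.eq_dec j i) as [->|Hji]; [lra|].
  specialize (Hother j Hj Hji); lra.
- intros _; lra.
Qed.

(** * Simultaneous hardness for all short descriptions *)

Fixpoint strings_le (n : nat) : list (list bool) :=
  match n with
  | O => nil :: nil
  | S k => nil :: map (cons true) (strings_le k) ++ map (cons false) (strings_le k)
  end.

Lemma in_strings_le (n : nat) (s : list bool) : (length s <= n)%nat -> In s (strings_le n).
Proof.
revert s; induction n as [|n IH]; intros [|a s]; simpl; auto; [lia|].
intros Hs; right; apply in_or_app; destruct a; [left|right]; apply in_map, IH; lia.
Qed.

(** The successor accounts for the test on the scales, added to one test per string. *)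
Lemma length_strings_le (n : nat) : S (length (strings_le n)) = (2 ^ S n)%nat.
Proof.
induction n as [|n IH]; [reflexivity|].
cbn [strings_le length]; rewrite length_app, !length_map.
change (2 ^ S (S n))%nat with (2 * 2 ^ S n)%nat; lia.
Qed.

Lemma nat_floor (x : R) : 0 <= x -> exists n : nat, INR n <= x < INR n + 1.
Proof.
intros Hx; destruct (archimed x) as (H1 & H2).
assert (Hup : (0 < up x)%Z) by (apply lt_IZR; lra).
exists (Z.to_nat (up x - 1)); rewrite INR_IZR_INZ, Z2Nat.id, minus_IZR by lia; lra.
Qed.

(** One test per short description bounds its payments from above, and one more bounds the sum of
    scales from below. The logarithm of the number of tests, times [H], is at most [N], so the
    scales lose at most [N] and the payments exceed [4N] by at most [2N]. *)
Lemma hard_scales (m N k : nat) (L : list bool -> auction m) (K H : R)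
    (s : nat -> nat -> R) :
  (forall i j, s i j = 0 \/ s i j = 1) -> 2 ^ k <= H -> 1 <= K ->
  2 * K * H <= INR N ->
  exists h : nat -> nat, (forall i, (h i <= k)%nat) /\
    INR N * (INR k / 4 - / 2) <= sumR N (fun i => 2 ^ h i) /\
    forall A, complexity_le L A K ->
      sumR N (fun i => snd (chosen A (s i) (h i))) <= 6 * INR N.
Proof.
intros Hs HkH HK HN; assert (Hk := pow2_ge_1 k).
destruct (nat_floor K ltac:(lra)) as (n & Hn1 & Hn2).
set (test A := fun i t => (snd (@chosen m A (s i) t) - 4) / (2 * H)).
set (scale := fun i t : nat => ((INR k / 2 + 1) / 2 - 2 ^ t) / H).
destruct (conditional_expectations k (eqrev k)
  (scale :: map (fun x => test (L x)) (strings_le n)) N) as (h & Hh & Htests).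
- apply eqrev_ge0.
- apply eqrev_mass.
- intros g i [<-|Hg]; [apply scale_moment, HkH|].
  apply in_map_iff in Hg; destruct Hg as (x & <- & _).
  apply payment_moment; auto.
- cbn [length] in Htests; rewrite length_map, length_strings_le in Htests.
  (* As [n <= K] and [1 <= K], [(n + 1) * ln 2 <= 2 * K]. *)
  assert (Hln : H * ln (INR (2 ^ S n)) <= INR N).
  { rewrite pow_INR, ln_pow, S_INR by (simpl; lra).
    replace (INR 2) with 2 by reflexivity.
    assert (H2 := ln_2_bounds); assert (Hn0 := pos_INR n).
    assert ((INR n + 1) * ln 2 <= 2 * K) by nra; nra. }
  set (l := ln (INR (2 ^ S n))) in *.
  exists h; split; [exact Hh|split].
  + assert (Ht := Htests scale (or_introl eq_refl)); unfold scale in Ht.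
    rewrite (sumR_ext _ _ (fun i => / H * (INR k / 4 + / 2) + - / H * 2 ^ h i)) in Ht
      by (intros; field; lra).
    rewrite sumR_plus, sumR_const, sumR_scal in Ht.
    apply Rmult_le_compat_l with (r := H) in Ht; [|lra].
    replace (H * (INR N * (/ H * (INR k / 4 + / 2)) + - / H * sumR N (fun i => 2 ^ h i)))
      with (INR N * (INR k / 4 + / 2) - sumR N (fun i => 2 ^ h i)) in Ht by (field; lra).
    lra.
  + intros A (x & <- & Hx).
    assert (Hin : In x (strings_le n)).
    { apply in_strings_le.
      assert (Hlt : INR (length x) < INR (S n)) by (rewrite S_INR; lra).
      apply INR_lt in Hlt; lia. }
    assert (Ht := Htests (test (L x)) (or_intror (in_map (fun x => test (L x)) _ _ Hin))).
    unfold test in Ht.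
    rewrite (sumR_ext _ _ (fun i => / (2 * H) * (- (4)) +
      / (2 * H) * snd (chosen (L x) (s i) (h i)))) in Ht by (intros; field; lra).
    rewrite sumR_plus, sumR_const, sumR_scal in Ht.
    apply Rmult_le_compat_l with (r := 2 * H) in Ht; [|lra].
    match type of Ht with ?a <= _ => replace a with
      (sumR N (fun i => snd (chosen (L x) (s i) (h i))) - 4 * INR N) in Ht
      by (field; lra) end.
    lra.
Qed.

(** * Choice of parameters and conclusion *)

Lemma log2_floor (H : R) : 1 < H -> exists k : nat, 2 ^ k <= H /\ ln H <= INR k + 1.
Proof.
intros HH; assert (H2 := ln_2_bounds).
assert (HlnH : 0 < ln H) by (rewrite <- ln_1; apply ln_increasing; lra).
destruct (nat_floor (ln H / ln 2)) as (k & Hk1 & Hk2).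
{ apply Rlt_le, Rdiv_lt_0_compat; lra. }
assert (E : ln H / ln 2 * ln 2 = ln H) by (field; lra).
exists k; split; [|assert (Hk0 := pos_INR k); nra].
apply Rnot_lt_le; intros Hlt; apply ln_increasing in Hlt; [|lra].
rewrite ln_pow in Hlt by lra; nra.
Qed.

(** The two factors bound the complexity and [H], so the code has enough words for [hard_scales].
    The floors cost at most 99 in [m <= 100 * n + 99], which [400 <= m] absorbs. *)
Lemma exponential_size (m : nat) : (400 <= m)%nat ->
  2 * Rpower 2 (INR m / 400) * Rpower 2 (INR m / 400) <= INR (2 ^ (m / 2 / 50)).
Proof.
intros Hm.
set (n := (m / 2 / 50)%nat).
assert (Hmn : (m <= 100 * n + 99)%nat).
{ assert (H1 := Nat.div_mod m 2 ltac:(lia)).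
  assert (H2 := Nat.mod_upper_bound m 2 ltac:(lia)).
  assert (H3 := Nat.div_mod (m / 2) 50 ltac:(lia)).
  assert (H4 := Nat.mod_upper_bound (m / 2) 50 ltac:(lia)).
  fold n in H3; lia. }
assert (Hle : INR m + 200 <= 200 * INR n).
{ replace 200 with (INR 200) by (rewrite INR_IZR_INZ; reflexivity).
  rewrite <- mult_INR, <- plus_INR; apply le_INR; lia. }
rewrite pow_INR, Rmult_assoc, <- Rpower_plus.
rewrite <- (Rpower_1 2) at 1 by lra; rewrite <- Rpower_plus.
replace (INR 2) with 2 by reflexivity; rewrite <- Rpower_pow by lra.
apply Rle_Rpower; lra.
Qed.

Theorem theorem2 :
  exists c : R, 0 < c /\
  forall (m : nat) (L : list bool -> auction m) (H : R),
    (1 <= m)%nat -> 1 < H -> H < Rpower 2 (INR m / 400) ->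
    exists D : fdist, is_dist D /\ supported_in m H D /\
      exists o : R, is_OPT m D o /\
      forall (A : auction m) (r : R),
        complexity_le L A (Rpower 2 (INR m / 400)) ->
        revenue_is A D r -> r <= c / ln H * o.
Proof.
(* The final comparison is [6 * ln H <= 6 * (k + 1) <= 288 * (k / 24)], valid for [k >= 1]. *)
exists 288; split; [lra|]; intros m L H Hm HH HHm.
assert (HlnH : 0 < ln H) by (rewrite <- ln_1; apply ln_increasing; lra).
(* For small [H] the factor [288 / ln H] is at least 1 and any distribution serves, here a point
   mass. *)
destruct (Rle_lt_dec (ln H) 288) as [Hsmall|Hlarge].
{ set (D := uniform_on (/ INR 1) (fun _ _ => 1) 1).
  assert (HD : is_dist D) by (apply uniform_on_dist; lia).
  assert (HS : supported_in m H D) by (apply uniform_on_supported; intros; lra).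
  destruct (OPT_exists m H D ltac:(lra) HD HS) as (o & Ho & Ho0).
  exists D; split; [exact HD|split; [exact HS|]].
  exists o; split; [exact Ho|]; intros A r _ Hr.
  assert (Hro : r <= o) by (apply Ho; exists A; exact Hr).
  assert (1 <= 288 / ln H).
  { apply Rmult_le_reg_r with (ln H); [lra|].
    unfold Rdiv; rewrite Rmult_assoc, Rinv_l by lra; lra. }
  nra. }
assert (Hm' : (400 <= m)%nat).
{ apply INR_le; rewrite INR_IZR_INZ; simpl IZR.
  assert (Hlt : ln H < INR m / 400 * ln 2).
  { apply exp_lt_inv; rewrite exp_ln by lra; exact HHm. }
  assert (H2 := ln_2_bounds); assert (H0 := pos_INR m); nra. }
destruct (log2_floor H HH) as (k & HkH & Hk).
set (b := (m / 2)%nat); set (n := (b / 50)%nat); set (N := (2 ^ n)%nat).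
assert (Hb : (0 < b /\ b + b <= m)%nat).
{ assert (H1 := Nat.div_mod m 2 ltac:(lia)).
  assert (H2 := Nat.mod_upper_bound m 2 ltac:(lia)).
  fold b in H1; lia. }
destruct (binary_code b n (Nat.Div0.mul_div_le b 50)) as (word & Hbit & Hagree).
fold N in Hagree.
set (s i := ind b (word i)).
assert (HK1 : 1 <= Rpower 2 (INR m / 400)) by lra.
assert (HN : 2 * Rpower 2 (INR m / 400) * H <= INR N).
{ apply Rle_trans with (2 := exponential_size m Hm'); nra. }
destruct (hard_scales m N k L _ H s (fun i => ind_01 b (word i)) HkH HK1 HN)
  as (h & Hh & Hsum & Hlow).
assert (HN0 : 0 < INR N) by nra.
assert (HiN : 0 < / INR N) by (apply Rinv_0_lt_compat; lra).
assert (HNN : / INR N * INR N = 1) by (apply Rinv_l; lra).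
set (v i := val (s i) (2 ^ h i)).
set (D := uniform_on (/ INR N) v N).
assert (HD : is_dist D) by (apply uniform_on_dist, INR_lt, HN0).
assert (HS : supported_in m H D).
{ apply uniform_on_supported; intros i j _ _.
  assert (Hv := val_bounds (s i) (2 ^ h i) j (ind_01 _ _ _) (pow2_ge_1 _)).
  assert (2 ^ h i <= 2 ^ k) by (apply Rle_pow; [lra|apply Hh]).
  unfold v; lra. }
destruct (OPT_exists m H D ltac:(lra) HD HS) as (o & Ho & _).
exists D; split; [exact HD|split; [exact HS|]].
exists o; split; [exact Ho|]; intros A r HA Hr.
assert (Hr6 : r <= 6).
{ rewrite (revenue_uniform_on A _ _ _ (fun i => snd (chosen A (s i) (h i))) r
    (Rgt_not_eq _ _ HiN) (fun i q _ => chosen_pays A (s i) (h i) q) Hr).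
  specialize (Hlow A HA); nra. }
(* The lotteries earn a third of the average scale, at least [k/12 - 1/6]; this exceeds [k/24]
   because [k] is large. *)
assert (Hok : INR k / 24 <= o).
{ destruct (lottery_auction b m N word (fun i => 2 ^ h i) (proj1 Hb) (proj2 Hb)
    Hbit Hagree (fun i => pow2_ge_1 (h i))) as (B & HB).
  assert (HoB : / INR N * sumR N (fun i => 2 ^ h i / 3) <= o).
  { apply Ho; exists B; apply revenue_uniform_on_intro; exact HB. }
  rewrite (sumR_ext _ _ (fun i => / 3 * 2 ^ h i)), sumR_scal in HoB by (intros; field).
  apply Rmult_le_compat_l with (r := / INR N) in Hsum; [|lra].
  rewrite <- Rmult_assoc, HNN in Hsum; lra. }
apply Rle_trans with (1 := Hr6).
apply Rmult_le_reg_r with (ln H); [lra|].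
replace (288 / ln H * o * ln H) with (288 * o) by (field; lra).
lra.
Qed.
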